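(* For any nonempty diagram class $D$ there is a polynomial $p_D(x_C)$ with rational coefficients, in the variables $x_C$, where $C$ runs over the set of connected diagram classes of size $1\le|C|\le|D|$, such that for all partitions $\lambda$ the number ${\sf r}_\lambda(D)$ is obtained from $p_D(x_C)$ by evaluating each $x_C$ at ${\sf r}_\lambda(C)$, that is, $$ {\sf r}_\lambda(D)=p_D({\sf r}_\lambda(C)); $$ and if $D$ is not connected, the polynomial $p_D(x_C)$ depends only on the variables $x_C$ with $|C|<|D|$.
   Context: A partition $\lambda$ is identified with its diagram $\{(i,j)\mid 1\le i\le \ell(\lambda),\ 1\le j\le\lambda_i\}\subset\mathbb N\times\mathbb N$. If $\alpha\subseteq\lambda$ are partitions, the skew diagram $\lambda/\alpha$ is the set of squares of $\lambda$ not in $\alpha$. Connectedness and connected components of skew diagrams refer to adjacency of squares along edges (connected diagrams are nonempty). Two skew diagrams are isomorphic if there is a bijection between their sets of connected components such that corresponding components are translates of one another. A diagram class is an isomorphism class $D=[\sigma]$ of skew diagrams; its size is $|D|=|\sigma|$, and it is connected if $\sigma$ is connected. For a partition $\lambda$ and a diagram class $D$, ${\sf r}_\lambda(D)$ is the number of $\lambda$-removable diagrams in $D$, i.e. the number of partitions $\alpha\subseteq\lambda$ such that $\lambda/\alpha\in D$. *)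

(* Defs.v *)
From HB Require Import structures.
From mathcomp Require Import all_boot all_order all_algebra finmap.
From mathcomp Require Import boolp classical_sets functions cardinality.
From mathcomp Require Import monalg.

Set Implicit Arguments.
Unset Strict Implicit.
Unset Printing Implicit Defensive.

Import GRing.Theory.
Local Open Scope fset_scope.

Record integer_partition := Partition {
  parts :> seq nat;
  _ : sorted geq parts && (0 \notin parts) }.
HB.instance Definition _ := [isSub for parts].
HB.instance Definition _ := [Choice of integer_partition by <:].

Notation square := (nat * nat)%type.

(* Rows and columns are numbered from 1, while [nth] numbers from 0. *)
Definition diagram (la : integer_partition) : {fset square} :=
  [fset x in [seq (i, j) | i <- iota 1 (size la), j <- iota 1 (nth 0 la i.-1)]].

Definition is_skew (s : {fset square}) :=
  exists la al : integer_partition,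
    diagram al `<=` diagram la /\ s = diagram la `\` diagram al.

Record skew_diagram := SkewDiagram {
  squares :> {fset square};
  _ : `[< is_skew squares >] }.
HB.instance Definition _ := [isSub for squares].
HB.instance Definition _ := [Choice of skew_diagram by <:].

Lemma skew_subproof (la al : integer_partition) :
  diagram al `<=` diagram la -> `[< is_skew (diagram la `\` diagram al) >].
Proof. by move=> h; apply/asboolP; exists la, al. Qed.

Definition skew (la al : integer_partition) (h : diagram al `<=` diagram la) :=
  SkewDiagram (skew_subproof h).

Definition adjacent (x y : square) : bool :=
  [|| (x.1 == y.1) && ((x.2 == y.2.+1) || (y.2 == x.2.+1))
    | (x.2 == y.2) && ((x.1 == y.1.+1) || (y.1 == x.1.+1))].

Definition linked (s : {fset square}) : rel s :=
  connect (fun x y : s => adjacent (val x) (val y)).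

Definition connected (s : {fset square}) : bool :=
  (s != fset0) && [forall x : s, forall y : s, linked x y].

Definition component (s : {fset square}) (x : s) : {fset square} :=
  [fset val y | y in linked x].

Definition components (s : {fset square}) : {fset {fset square}} :=
  [fset component x | x : s].

Definition shift (v : int * int) (x : square) : int * int :=
  (x.1%:Z + v.1, x.2%:Z + v.2)%R.

(* The translation vector may have negative coordinates, so the comparison
   takes place in Z x Z. *)
Definition translates (s t : {fset square}) :=
  exists v : int * int, [fset shift v x | x in s] = [fset shift 0%R x | x in t].

Definition isomorphic (s t : {fset square}) :=
  exists f : {fset square} -> {fset square},
    set_bij [set` components s] [set` components t] f /\
    (forall c, c \in components s -> translates c (f c)).

Lemma shift_inj v : injective (shift v).
Proof.
by move=> [a b] [c d] [] /addIr [] -> /addIr [] ->.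
Qed.

Lemma translates_refl s : translates s s.
Proof. by exists 0%R. Qed.

Lemma translatesP s t : translates s t <->
  exists v w, [fset shift v x | x in s] = [fset shift w x | x in t].
Proof.
split=> [[v e]|[v [w e]]]; first by exists v, 0%R.
exists (v - w)%R.
have sh u (r : {fset square}) :
  [fset shift (u - w)%R x | x in r] =
  [fset (y - w)%R | y in [fset shift u x | x in r]].
  apply/fsetP=> y; apply/imfsetP/imfsetP => /= -[x xr ->].
    exists (shift u x); first by apply/imfsetP; exists x.
    by congr pair; rewrite /= addrA.
  case/imfsetP: xr => /= z zr ->; exists z => //.
  by congr pair; rewrite /= addrA.
by rewrite sh e -sh subrr.
Qed.

Lemma translates_sym s t : translates s t -> translates t s.
Proof. by case=> v e; apply/translatesP; exists 0%R, v. Qed.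

Lemma translates_trans s t u : translates s t -> translates t u -> translates s u.
Proof.
move=> [v e] [w e']; apply/translatesP; exists (v + w)%R, 0%R.
rewrite -e'.
have sh a (r : {fset square}) :
  [fset shift (a + w)%R x | x in r] =
  [fset (y + w)%R | y in [fset shift a x | x in r]].
  apply/fsetP=> y; apply/imfsetP/imfsetP => /= -[x xr ->].
    exists (shift a x); first by apply/imfsetP; exists x.
    by congr pair; rewrite /= addrA.
  case/imfsetP: xr => /= z zr ->; exists z => //.
  by congr pair; rewrite /= addrA.
by rewrite sh e -sh add0r.
Qed.

Lemma card_translates s t : translates s t -> #|` s| = #|` t|.
Proof.
case=> v e; have /(congr1 (fun A : {fset _} => #|` A|)) := e.
by rewrite !card_imfset //; apply: shift_inj.
Qed.

Lemma isomorphic_refl s : isomorphic s s.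
Proof.
exists id; split; last by move=> c _; apply: translates_refl.
by split=> [x|x y _ _|x] //= xs; exists x.
Qed.

Lemma isomorphic_sym s t : isomorphic s t -> isomorphic t s.
Proof.
move=> [f [[fst finj fsur] tf]].
have /choice[g gP] : forall d, exists c, d \in components t ->
    c \in components s /\ f c = d.
  move=> d; case: (boolP (d \in components t)) => [/fsur[c cs <-]|_].
    by exists c.
  by exists d.
have inS c : c \in components s -> c \in [set` components s]%classic.
  by move=> cs; apply/mem_set.
exists g; split; last first.
  move=> d /gP[gs fg]; apply: translates_sym; rewrite -[X in translates _ X]fg.
  exact: tf.
split=> [d dt|d e /set_mem dt /set_mem et eg|c cs].
- by case: (gP _ dt).
- by case: (gP _ dt) => _ <-; case: (gP _ et) => _ <-; rewrite eg.
- exists (f c); first exact: fst.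
  have [gs fg] := gP _ (fst _ cs).
  by apply: finj fg; apply: inS.
Qed.

Lemma isomorphic_trans s t u :
  isomorphic s t -> isomorphic t u -> isomorphic s u.
Proof.
move=> [f [bf tf]] [g [bg tg]]; exists (g \o f); split.
  exact: set_bij_comp bf bg.
move=> c cs; apply: translates_trans (tf _ cs) _; apply: tg.
by case: bf => + _ _; apply.
Qed.

Definition skew_iso : rel skew_diagram := fun s t => `[< isomorphic s t >].

Lemma skew_iso_refl : reflexive skew_iso.
Proof. by move=> s; apply/asboolP/isomorphic_refl. Qed.

Lemma skew_iso_sym : symmetric skew_iso.
Proof.
by move=> s t; apply/asboolP/asboolP; apply: isomorphic_sym.
Qed.

Lemma skew_iso_trans : transitive skew_iso.
Proof.
move=> t s u /asboolP st /asboolP tu; apply/asboolP.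
exact: isomorphic_trans st tu.
Qed.

Canonical skew_iso_equiv :=
  EquivRel skew_iso skew_iso_refl skew_iso_sym skew_iso_trans.

Definition diagram_class := {eq_quot skew_iso}%qT.
HB.instance Definition _ := Choice.on diagram_class.

Definition class_of (s : skew_diagram) : diagram_class := \pi_diagram_class%qT s.

(* Size and connectedness are read off a representative; they do not depend on
   its choice, see [class_sizeE] and [class_connectedE]. *)
Definition class_size (D : diagram_class) : nat := #|` squares (repr D)|.

Definition class_connected (D : diagram_class) : bool :=
  connected (squares (repr D)).

Lemma class_ofP (s t : skew_diagram) :
  class_of s = class_of t <-> isomorphic s t.
Proof.
split=> [/eqmodP/asboolP //|st].
by apply/eqmodP; apply/asboolP.
Qed.

Lemma linked_sym (s : {fset square}) : symmetric (@linked s).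
Proof.
apply: sym_connect_sym => x y /=; rewrite /adjacent.
rewrite (eq_sym (val x).1 (val y).1) (eq_sym (val x).2 (val y).2).
by congr (_ && _ || _ && _); rewrite orbC.
Qed.

Lemma mem_component (s : {fset square}) (x y : s) :
  (val y \in component x) = linked x y.
Proof.
apply/imfsetP/idP => [[z /= xz /val_inj ->] //|xy].
by exists y.
Qed.

Lemma component_sub (s : {fset square}) (x : s) : component x `<=` s.
Proof. by apply/fsubsetP => _ /imfsetP[y _ ->]; apply: valP. Qed.

Lemma eq_component (s : {fset square}) (x y : s) :
  linked x y -> component x = component y.
Proof.
move=> xy; apply/fsetP => z; apply/idP/idP => zc.
  have zs := fsubsetP (component_sub x) _ zc.
  move: zc; rewrite -[z]/(val [` zs]) !mem_component.
  by apply: connect_trans; rewrite -/(linked _ _) linked_sym.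
have zs := fsubsetP (component_sub y) _ zc.
move: zc; rewrite -[z]/(val [` zs]) !mem_component.
exact: connect_trans.
Qed.

Lemma components_trivI s : trivIfset (components s).
Proof.
apply/trivIfsetP => _ _ /imfsetP[/= x _ ->] /imfsetP[/= y _ ->] nxy.
apply/fdisjointP => z zx; apply: contra nxy => zy.
have zs := fsubsetP (component_sub x) _ zx.
move: zx zy; rewrite -[z]/(val [` zs]) !mem_component => xz yz.
apply/eqP/eq_component; apply: connect_trans xz _.
by rewrite -/(linked _ _) linked_sym.
Qed.

Lemma fcover_components s : fcover (components s) = s.
Proof.
apply/fsetP => x; apply/bigfcupP/idP => [[_ /andP[/imfsetP[/= y _ ->] _]]|xs].
  exact/fsubsetP/component_sub.
exists (component [` xs]); last by rewrite -[x]/(val [` xs]) mem_component /linked connect0.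
by rewrite andbT; apply/imfsetP; exists [` xs].
Qed.

Lemma connectedE s : connected s = (#|` components s| == 1%N).
Proof.
apply/idP/cardfs1P => [/andP[/fset0Pn[x xs] /forallP sP]|[c cE]].
  exists (component [` xs]); apply/fsetP => c; rewrite inE.
  apply/imfsetP/eqP => [[/= y _ ->]|->]; last by exists [` xs].
  by apply/esym/eq_component; have /forallP := sP [` xs]; apply.
have inc (x : s) : component x = c.
  by apply/fset1P; rewrite -cE; apply/imfsetP; exists x.
apply/andP; split; last first.
  apply/forallP => x; apply/forallP => y.
  by rewrite -mem_component inc -(inc y) mem_component /linked connect0.
have : c \in components s by rewrite cE fset11.
by case/imfsetP => /= x _ _; apply/fset0Pn; exists (val x); apply: valP.
Qed.

Lemma isomorphic_components s t : isomorphic s t ->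
  exists2 f : {fset square} -> {fset square},
    {in components s &, injective f} /\ components t = f @` components s
    & forall c, c \in components s -> translates c (f c).
Proof.
move=> [f [[fst finj fsur] tf]]; exists f => //; split.
  by move=> c d cs ds; apply: finj; apply/mem_set.
apply/fsetP => d; apply/idP/imfsetP => [/fsur[c cs <-]|[/= c cs ->]].
  by exists c.
exact: fst.
Qed.

Lemma isomorphic_connected s t : isomorphic s t -> connected s = connected t.
Proof.
case/isomorphic_components => f [finj ft] _.
by rewrite !connectedE ft (@card_in_imfset _ _ _ f).
Qed.

Lemma isomorphic_card s t : isomorphic s t -> #|` s| = #|` t|.
Proof.
case/isomorphic_components => f [finj ft] tf.
have cE u : #|` u| = (\sum_(c <- components u) #|` c|)%N.
  by rewrite (eqP (components_trivI u)) fcover_components.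
rewrite (cE t) ft big_imfset //= (cE s) !big_seq.
by apply: eq_bigr => c /tf /card_translates.
Qed.

Lemma class_sizeE s : class_size (class_of s) = #|` squares s|.
Proof. by apply/isomorphic_card/class_ofP; rewrite /class_of reprK. Qed.

Lemma class_connectedE s : class_connected (class_of s) = connected s.
Proof. by apply/isomorphic_connected/class_ofP; rewrite /class_of reprK. Qed.

Local Open Scope classical_set_scope.

Definition removable (la : integer_partition) (D : diagram_class) : set integer_partition :=
  [set al | exists h : (diagram al `<=` diagram la)%fset,
              class_of (skew h) = D].

Lemma mem_diagram (la : integer_partition) i j :
  ((i, j) \in diagram la) = [&& 0 < i, 0 < j & j <= nth 0 la i.-1]%N.
Proof.
rewrite inE /=; apply/allpairsPdep/idP => [[a [b []]]|].
  rewrite !mem_iota add1n !ltnS => /andP[a0 _] /andP[b0 bj] [-> ->].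
  by rewrite a0 b0.
move=> /and3P[i0 j0 jl]; exists i, j; rewrite !mem_iota !add1n !ltnS i0 j0 jl.
split=> //; rewrite leqNgt; apply/negP => si.
move: jl; rewrite nth_default; last by case: (i) i0 si.
by rewrite leqNgt j0.
Qed.

Lemma diagram_inj : injective diagram.
Proof.
move=> la mu e; apply/val_inj => /=.
have nthE k : nth 0 la k = nth 0 mu k.
  have le p q : diagram p = diagram q -> (nth 0 p k <= nth 0 q k)%N.
    case E: (nth 0 p k) => [//|n] dE.
    have : (k.+1, n.+1) \in diagram p by rewrite mem_diagram /= E ltnSn.
    by rewrite dE mem_diagram.
  by apply/eqP; rewrite eqn_leq !le.
have sz p q : (forall k, nth 0 (parts p) k = nth 0 (parts q) k) ->
    (size p <= size q)%N.
  move=> pq; rewrite leqNgt; apply/negP => qp.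
  case: p pq qp => p /= /andP[_ /negP]; move=> p0 pq qp; case: p0.
  by rewrite -(nth_default 0 (leqnn (size q))) -pq mem_nth.
apply: (@eq_from_nth _ 0) => [|k _ //].
by apply/eqP; rewrite eqn_leq !sz.
Qed.

Lemma finite_removable la D : finite_set (removable la D).
Proof.
have := @finite_preimage _ _ [set` fpowerset (diagram la)] diagram.
move=> /(_ _ (finite_fset _)) fin; apply: sub_finite_set (fin _).
  by move=> al [h _] /=; rewrite fpowersetE.
by move=> ? ? _ _; apply: diagram_inj.
Qed.

(* [fset_set] is only meaningful on finite sets, hence [finite_removable]. *)
Definition nremovable (la : integer_partition) (D : diagram_class) : nat :=
  #|` fset_set (removable la D)|.

Local Open Scope ring_scope.

Definition class_var (n : nat) :=
  {C : diagram_class | class_connected C && (1 <= class_size C <= n)%N}.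

(* Polynomials with coefficients in [R] and commuting variables in [I]: finitely
   supported [R]-combinations of the monomials of the free commutative monoid on
   [I]. *)
Definition mpolynomial (R : comNzRingType) (I : choiceType) :=
  {malg R[{cmonom I}]}.

Definition poly_eval (R : comNzRingType) (I : choiceType) (v : I -> R)
    (p : mpolynomial R I) : R :=
  mmap idfun (fun m : {cmonom I} => \prod_(i <- finsupp m) v i ^+ m i) p.

Definition poly_vars (R : comNzRingType) (I : choiceType)
    (p : mpolynomial R I) : set I :=
  [set i | exists2 m : {cmonom I}, m \in msupp p & i \in finsupp m].

(* Main.v *)
From HB Require Import structures.
Require Import Defs.
From mathcomp Require Import all_boot all_order all_algebra finmap.
From mathcomp Require Import boolp classical_sets functions cardinality.
From mathcomp Require Import monalg zify.

(** Removing squares from a partition la means removing a set s of squares that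
    contains, with each square, its neighbours in la to the east and to the
    south: an upset of la ([nremovableE]).  Unions of upsets are upsets, and an
    upset of an upset of la is an upset of la.  So if D1 and D2 are classes, the
    product r_la(D1) r_la(D2) counts the pairs of upsets of la of these classes;
    sorting the pairs by their union s, and the unions by their class E, gives
      r_la(D1) r_la(D2) = sum over E of c(E) r_la(E),
    where c(E) is the number of ways to cover one fixed diagram in E by an upset
    of class D1 and an upset of class D2 ([nremovableM]).  The number c(E) does
    not depend on la, nor on the diagram chosen in E.

    If D is not connected, take for D1 the class of one component of a diagram
    in D, and for D2 the class of the rest.  Then c(D) > 0.  If c(E) > 0, then
    |E| <= |D1| + |D2| = |D|, and |E| = |D| forces the two upsets to be
    disjoint; disjoint upsets have no adjacent squares, so that E is the disjoint
    sum of D1 and D2, that is E = D ([disconnected_split]).  Hence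
      r_la(D) = (r_la(D1) r_la(D2) - sum over |E| < |D| of c(E) r_la(E)) / c(D),
    a finite sum by [finite_classes], and induction on |D| concludes.  If D is
    connected, its polynomial is the variable x_D.

    Isomorphism of diagrams, defined through components and translations, is
    used in an equivalent form: a bijection of squares that preserves and
    reflects the two relations of being the east and the south neighbour
    ([isomorphicP]).  In this form its invariants (upsets, numbers of covering
    pairs) are immediate, and so is the finiteness of the number of classes of
    bounded size. *)

Set Implicit Arguments.
Unset Strict Implicit.
Unset Printing Implicit Defensive.

Import GRing.Theory.
Local Open Scope fset_scope.

Implicit Types (s t u c : {fset square}) (x y : square).
Implicit Types D E : diagram_class.

(** * Isomorphism as a local isometry *)

(** Squares are (row, column) pairs: rows grow southwards, columns eastwards. *)
Definition east x y := (y.1 == x.1) && (y.2 == x.2.+1).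

Definition south x y := (y.1 == x.1.+1) && (y.2 == x.2).

Lemma adjacentE x y :
  adjacent x y = [|| east x y, east y x, south x y | south y x].
Proof.
rewrite /adjacent /east /south.
rewrite (eq_sym y.1 x.1) (eq_sym y.2 x.2) !andb_orr !orbA.
by rewrite [_ && (x.2 == y.2.+1) || _]orbC -!orbA;
  congr [|| _, _ | _]; rewrite orbC ![_ && (x.2 == y.2)]andbC.
Qed.

(** Rigidity asks nothing of two squares in different components beyond their
    images being distinct and not adjacent, so that components may be moved
    independently. *)
Definition rigid s (phi : square -> square) :=
  {in s &, injective phi} /\
  {in s &, forall x y, east (phi x) (phi y) = east x y
                    /\ south (phi x) (phi y) = south x y}.

Definition congruent s t := exists2 phi, rigid s phi & t = phi @` s.

Lemma rigid_adjacent s phi : rigid s phi ->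
  {in s &, forall x y, adjacent (phi x) (phi y) = adjacent x y}.
Proof.
move=> [_ rd] x y xs ys; rewrite !adjacentE.
by have [-> ->] := rd x y xs ys; have [-> ->] := rd y x ys xs.
Qed.

Lemma rigid_sub s t phi : s `<=` t -> rigid t phi -> rigid s phi.
Proof.
move=> /fsubsetP st [inj rd]; split=> x y xs ys.
  by apply: inj; apply: st.
by apply: rd; apply: st.
Qed.

Lemma congruent_sym s t : congruent s t -> congruent t s.
Proof.
move=> [phi [inj rd] ->].
have /choice[psi psiP] : forall y, exists x, y \in phi @` s -> x \in s /\ phi x = y.
  move=> y; case: (boolP (y \in phi @` s)) => [/imfsetP[x /= xs ->]|_].
    by exists x.
  by exists y.
have psiK x : x \in s -> psi (phi x) = x.
  move=> xs; have [ps e] := psiP _ (in_imfset _ phi xs).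
  exact: inj.
exists psi; last first.
  apply/fsetP=> x; apply/idP/imfsetP => [xs|[_ /imfsetP[y /= ys ->] ->]].
    by exists (phi x); rewrite ?psiK // in_imfset.
  by rewrite psiK.
split=> [_ _ /imfsetP[x /= xs ->] /imfsetP[y /= ys ->]|].
  by rewrite !psiK // => ->.
move=> _ _ /imfsetP[x /= xs ->] /imfsetP[y /= ys ->].
by rewrite !psiK //; have [-> ->] := rd x y xs ys.
Qed.

Lemma congruent_card s t : congruent s t -> #|` t| = #|` s|.
Proof. by move=> [phi [inj _] ->]; rewrite card_in_imfset. Qed.

(** Connectedness in induction form, with no reference to paths: a property that
    propagates along adjacency holds on a whole component. *)
Lemma components_ind s c (P : square -> Prop) x : c \in components s ->
  x \in c -> P x ->
  (forall a b, a \in s -> b \in s -> adjacent a b -> P a -> P b) ->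
  forall y, y \in c -> P y.
Proof.
move=> /imfsetP[/= z _ ->] xz Px step y yz.
have xs := fsubsetP (component_sub z) _ xz.
have ys := fsubsetP (component_sub z) _ yz.
have : linked [` xs] [` ys].
  apply: (@connect_trans _ _ z); last by rewrite -/(linked _ _) -mem_component.
  by rewrite -/(linked _ _) linked_sym -mem_component.
move=> /connectP[p pth lst]; have -> : y = val (last [` xs] p) by rewrite -lst.
have : P (val [` xs]) by [].
elim: p [` xs] pth {lst} => //= b p IH a /andP[ab pth] Pa.
by apply: IH pth _; apply: step ab Pa; apply: valP.
Qed.

Lemma components_closed s c x y : c \in components s -> x \in c -> y \in s ->
  adjacent x y -> y \in c.
Proof.
move=> /imfsetP[/= z _ ->] xz ys xy.
have xs := fsubsetP (component_sub z) _ xz.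
move: xz; rewrite -[x]/(val [` xs]) -[y]/(val [` ys]) !mem_component => xz.
by apply: connect_trans xz _; apply: connect1.
Qed.

Lemma components_ex s x : x \in s -> exists2 c, c \in components s & x \in c.
Proof.
move=> xs; exists (component [` xs]); first by apply/imfsetP; exists [` xs].
by rewrite -[x]/(val [` xs]) mem_component /linked connect0.
Qed.

(** Together, closure under adjacency and induction along adjacency characterise
    components; both transport along a rigid map without its inverse. *)
Lemma componentsI s c x : c `<=` s -> x \in c ->
  (forall a b, a \in c -> b \in s -> adjacent a b -> b \in c) ->
  (forall P : square -> Prop, P x ->
     (forall a b, a \in s -> b \in s -> adjacent a b -> P a -> P b) ->
     forall y, y \in c -> P y) ->
  c \in components s.
Proof.
move=> cs xc cl ind; have [d dd xd] := components_ex (fsubsetP cs _ xc).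
have cld a b := @components_closed s d a b dd.
suff -> : c = d by []; apply/fsetP => y; apply/idP/idP => yc.
  by apply: (ind (fun z => z \in d)) yc => // a b _ bs ab ad; apply: cld ab.
apply: (components_ind (P := fun z => z \in c) dd xd xc _ yc).
by move=> a b _ bs ab ac; apply: cl ab.
Qed.

Lemma components_sub s c : c \in components s -> c `<=` s.
Proof. by move=> /imfsetP[/= z _ ->]; apply: component_sub. Qed.

Lemma components_neq0 s c : c \in components s -> exists x, x \in c.
Proof.
move=> /imfsetP[/= z _ ->]; exists (val z).
by rewrite mem_component /linked connect0.
Qed.

Lemma components_eq s c d x : c \in components s -> d \in components s ->
  x \in c -> x \in d -> c = d.
Proof.
move=> cs ds xc xd; apply/eqP; apply/negPn/negP => ncd.
have /trivIfsetP/(_ _ _ cs ds ncd)/fdisjointP/(_ _ xc) := components_trivI s.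
by rewrite xd.
Qed.

(** Translations preserve relative positions: this makes an isomorphism of
    diagrams rigid inside each component. *)
Lemma shift_east_south v w x x' y y' : shift v x = shift w x' ->
  shift v y = shift w y' -> east x' y' = east x y /\ south x' y' = south x y.
Proof.
case: v w x x' y y' => [v1 v2] [w1 w2] [a b] [a' b'] [c d] [c' d'].
rewrite /shift /east /south /= => -[e1 e2] [e3 e4].
by split; apply/andP/andP => -[/eqP h1 /eqP h2]; split; apply/eqP; lia.
Qed.

(** Conversely the displacement caused by a rigid map is the same for adjacent
    squares, hence constant on components. *)
Lemma shift_step v w x y x' y' :
  east x' y' = east x y -> east y' x' = east y x ->
  south x' y' = south x y -> south y' x' = south y x -> adjacent x y ->
  shift v x = shift w x' -> shift v y = shift w y'.
Proof.
case: v w x x' y y' => [v1 v2] [w1 w2] [a b] [a' b'] [c d] [c' d'].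
rewrite adjacentE /shift /east /south /= => r1 r2 d1 d2 adj [e1 e2].
case/or4P: adj => adj; move: r1 r2 d1 d2; rewrite adj => r1 r2 d1 d2.
- by move: adj r1 => /andP[/eqP h1 /eqP h2] /andP[/eqP h3 /eqP h4]; congr pair; lia.
- by move: adj r2 => /andP[/eqP h1 /eqP h2] /andP[/eqP h3 /eqP h4]; congr pair; lia.
- by move: adj d1 => /andP[/eqP h1 /eqP h2] /andP[/eqP h3 /eqP h4]; congr pair; lia.
- by move: adj d2 => /andP[/eqP h1 /eqP h2] /andP[/eqP h3 /eqP h4]; congr pair; lia.
Qed.

(** From left to right, translate each component onto its partner; squares of
    distinct components are not adjacent, before or after.  From right to left,
    a rigid map sends components to components and is a translation on each. *)
Lemma isomorphicP s t : isomorphic s t <-> congruent s t.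
Proof.
split=> [[f [[fst finj fsur] tf]]|[phi rphi ->]].
  have /choice[v vP] : forall c, exists v : int * int, c \in components s ->
      [fset shift v x | x in c] = [fset shift 0%R x | x in f c].
    move=> c; case: (boolP (c \in components s)) => [/tf[v e]|_].
      by exists v.
    by exists 0%R.
  have /choice[phi phiP] : forall x, exists y, x \in s -> exists c,
      [/\ c \in components s, x \in c, y \in f c
        & shift (v c) x = shift 0%R y].
    move=> x; case: (boolP (x \in s)) => [/components_ex[c cs xc]|_].
      have /fsetP/(_ (shift (v c) x)) := vP _ cs.
      rewrite in_imfset // => /esym/imfsetP[y /= yfc e].
      by exists y => _; exists c.
    by exists x.
  have fcomp c : c \in components s -> f c \in components t by move=> /fst.
  have fI c d : c \in components s -> d \in components s -> f c = f d -> c = d.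
    by move=> cs ds; apply: finj; apply/mem_set.
  (* [phi] is the translation by [v c] on each component [c]. *)
  exists phi.
    split=> [x y xs ys exy|x y xs ys].
      have [c [cs xc xfc ex]] := phiP _ xs; have [d [ds yd yfd ey]] := phiP _ ys.
      have ecd : c = d.
        apply: fI => //; apply: (components_eq (fcomp _ cs) (fcomp _ ds) xfc).
        by rewrite exy.
      by move: ey; rewrite -ecd -exy -ex => /shift_inj.
    have [c [cs xc xfc ex]] := phiP _ xs; have [d [ds yd yfd ey]] := phiP _ ys.
    have [ecd|necd] := pselect (c = d).
      by apply: shift_east_south ex _; rewrite ecd.
    have nxy : ~~ adjacent x y.
      apply/negP => xy; apply: necd; apply: (components_eq cs ds _ yd).
      exact: (components_closed cs xc ys xy).
    have nfxy : ~~ adjacent (phi x) (phi y).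
      apply/negP => xy; apply: necd; apply: fI => //.
      apply: (components_eq (fcomp _ cs) (fcomp _ ds) _ yfd).
      apply: (components_closed (fcomp _ cs) xfc _ xy).
      exact: (fsubsetP (components_sub (fcomp _ ds))).
    move: nxy nfxy; rewrite !adjacentE !negb_or.
    by move=> /and4P[/negPf-> _ /negPf-> _] /and4P[/negPf-> _ /negPf-> _].
  apply/fsetP=> y; apply/idP/imfsetP => [yt|[x /= xs ->]].
    have [d dt yd] := components_ex yt.
    have [c cs fc] := fsur _ dt.
    have /fsetP/(_ (shift 0%R y)) := vP _ cs.
    rewrite fc [RHS]in_imfset // => /imfsetP[x /= xc e].
    have xs := fsubsetP (components_sub cs) _ xc.
    exists x => //; have [c' [c's xc' _ ex]] := phiP _ xs.
    have ec : c' = c by apply: (components_eq c's cs xc').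
    by apply: (@shift_inj 0%R); rewrite -ex ec e.
  have [c [cs xc xfc _]] := phiP _ xs.
  exact: (fsubsetP (components_sub (fcomp _ cs))).
have [inj rd] := rphi; have adj := rigid_adjacent rphi.
have imc c : c \in components s -> phi @` c \in components (phi @` s).
  move=> cs; have [x xc] := components_neq0 cs.
  have sub := fsubsetP (components_sub cs).
  apply: (@componentsI _ _ (phi x)).
  - apply/fsubsetP=> _ /imfsetP[y /= yc ->]; apply: in_imfset; exact: sub.
  - exact: in_imfset.
  - move=> _ _ /imfsetP[a /= ac ->] /imfsetP[b /= bs ->].
    rewrite (adj _ _ (sub _ ac) bs) => ab; apply: in_imfset.
    exact: (components_closed cs ac bs ab).
  - move=> P Px step _ /imfsetP[y /= yc ->].
    apply: (components_ind (P := P \o phi) cs xc) => // a b as_ bs ab.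
    by apply: step; rewrite ?in_imfset ?adj.
exists (fun c => phi @` c); split; last first.
  move=> c cs; have [x xc] := components_neq0 cs.
  have sub := fsubsetP (components_sub cs).
  exists ((phi x).1%:Z - x.1%:Z, (phi x).2%:Z - x.2%:Z)%R.
  set v := (X in shift X).
  have e : {in c, forall y, shift v y = shift 0%R (phi y)}.
    apply: (components_ind (x := x) cs) => //.
      by rewrite /shift /= addrC subrK addrC subrK !addr0.
    move=> a b as_ bs ab; have [ra da] := rd a b as_ bs.
    by have [rb db] := rd b a bs as_; apply: shift_step ab.
  apply/fsetP=> z; apply/imfsetP/imfsetP => /= -[y].
    by move=> yc ->; exists (phi y); rewrite ?in_imfset ?e.
  by move=> /imfsetP[y' /= yc ->] ->; exists y'; rewrite ?e.
split=> [c /imc //|c d|d ds].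
  rewrite !inE /= => cs ds /fsetP e; apply/fsetP.
  have half c' d' : c' \in components s -> d' \in components s ->
      phi @` c' =i phi @` d' -> forall x, x \in c' -> x \in d'.
    move=> cs' ds' e' x xc; move: (e' (phi x)); rewrite in_imfset //.
    move=> /esym/imfsetP[y /= yd /inj ->] //.
      exact: (fsubsetP (components_sub cs')).
    exact: (fsubsetP (components_sub ds')).
  by move=> x; apply/idP/idP; apply: half => // y; rewrite e.
have [y yd] := components_neq0 ds.
have /imfsetP[x /= xs ex] := fsubsetP (components_sub ds) _ yd.
have [c cs xc] := components_ex xs.
exists c => //; apply: (components_eq (imc _ cs) ds _ yd).
by rewrite ex in_imfset.
Qed.

(** * Removable diagrams as upsets *)

(** Closure is asked one step at a time, because rigid maps preserve neighbours
    and not the order between distant squares. *)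
Definition upset s t :=
  s `<=` t /\ {in s & t, forall x y, east x y || south x y -> y \in s}.

Lemma part_le (la : integer_partition) k : nth 0 la k.+1 <= nth 0 la k.
Proof.
have [lt|ge] := ltnP k.+1 (size la); last by rewrite nth_default.
by case: la lt => la /= /andP[/(sortedP 0) h _] /h.
Qed.

Lemma partition_of_rows (rho : nat -> nat) n :
  (forall k, rho k.+1 <= rho k) -> rho n = 0 ->
  exists al : integer_partition, forall k, nth 0 al k = rho k.
Proof.
move=> dec rho0.
have ex : exists k, rho k == 0 by exists n; rewrite rho0.
(* The sequence of parts stops at the first empty row: parts are nonzero. *)
case: (ex_minnP ex) => m /eqP m0 mmin.
have rho_ge k : m <= k -> rho k = 0.
  move=> /subnK <-; elim: (k - m) => [|i IH] //.
  by apply/eqP; rewrite -leqn0 -IH; apply: dec.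
have ok : sorted geq (mkseq rho m) && (0 \notin mkseq rho m).
  apply/andP; split.
    apply/(sortedP 0) => i; rewrite size_mkseq => im.
    by rewrite !nth_mkseq //=; apply: ltnW.
  apply/mapP => -[k]; rewrite mem_iota add0n => /andP[_ km] k0.
  by move: km; rewrite ltnNge mmin // -k0.
exists (Partition ok) => k /=.
have [km|mk] := ltnP k m; first by rewrite nth_mkseq.
by rewrite nth_default ?size_mkseq // rho_ge.
Qed.

Lemma diagram_step (la : integer_partition) x y : 0 < x.1 -> 0 < x.2 ->
  east x y || south x y -> y \in diagram la -> x \in diagram la.
Proof.
case: x y => [i j] [i' j'] /= i0 j0.
rewrite !mem_diagram /east /south /= i0 j0 /=.
move=> /orP[]/andP[/eqP-> /eqP->] /and3P[_ _]; first exact: ltnW.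
by case: i i0 => // i _ /= h; apply: leq_trans h (part_le _ _).
Qed.

Lemma diagram_skew_upset (la al : integer_partition) :
  upset (diagram la `\` diagram al) (diagram la).
Proof.
split; first exact: fsubsetDl.
move=> [i j] y /[!in_fsetD] /andP[nal la_x] la_y step.
rewrite la_y andbT; apply: contra nal.
move: la_x; rewrite mem_diagram => /and3P[i0 j0 _].
exact: diagram_step step.
Qed.

(** Row i of the complement ends at the first square that belongs to s; the
    upset condition says that the row contains no square after it and that the
    lengths of the rows decrease. *)
Lemma diagram_of_upset_compl (la : integer_partition) s :
  upset s (diagram la) -> exists al, diagram al = diagram la `\` s.
Proof.
move=> [sub up]; set L := _ `\` _.
have lower x y : 0 < x.1 -> 0 < x.2 -> east x y || south x y -> y \in L -> x \in L.
  rewrite !in_fsetD => x1 x2 xy /andP[ys yla].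
  have xla := diagram_step x1 x2 xy yla.
  by rewrite xla andbT; apply: contra ys => xs; apply: up xy.
have /choice[rho rhoP] : forall i, exists r, forall j, ((i.+1, j.+1) \in L) = (j < r).
  move=> i; have ex : exists j, (i.+1, j.+1) \notin L.
    exists (nth 0 la i); rewrite in_fsetD mem_diagram /= ltnn andbF //.
  case: (ex_minnP ex) => r rL rmin; exists r => j; apply/idP/idP => [jL|].
    rewrite ltnNge; apply: contra rL => /subnK e; move: jL; rewrite -e.
    elim: (j - r) => [|k IH] // h; apply: IH.
    by apply: lower h => //; rewrite /east /= !eqxx.
  by move=> jr; apply/negPn/negP => /rmin; rewrite leqNgt jr.
have dec k : rho k.+1 <= rho k.
  rewrite leqNgt -rhoP; apply/negP => h.
  suff : (k.+1, (rho k).+1) \in L by rewrite rhoP ltnn.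
  by apply: lower h => //; rewrite /south /= !eqxx orbT.
have rho0 : rho (size la) = 0.
  apply/eqP; rewrite -leqn0 leqNgt -rhoP in_fsetD mem_diagram /=.
  by rewrite nth_default // andbF.
have [al alE] := partition_of_rows dec rho0.
exists al; apply/fsetP=> -[[|i] [|j]].
- by rewrite /L in_fsetD !mem_diagram /= andbF.
- by rewrite /L in_fsetD !mem_diagram /= andbF.
- by rewrite /L in_fsetD !mem_diagram /= andbF.
by rewrite mem_diagram rhoP /= alE.
Qed.

Lemma upset_skew (la : integer_partition) s : upset s (diagram la) ->
  exists2 al, diagram al `<=` diagram la & s = diagram la `\` diagram al.
Proof.
move=> up; have [al alE] := diagram_of_upset_compl up; exists al.
  by rewrite alE fsubsetDl.
by rewrite alE fsetDK //; case: up.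
Qed.

Lemma class_ofE (sk : skew_diagram) (D : diagram_class) :
  class_of sk = D <-> congruent (squares (repr D)) (squares sk).
Proof.
rewrite -[D in _ = D](reprK D) -/(class_of _) class_ofP isomorphicP.
by split; apply: congruent_sym.
Qed.

Definition upsets t : {fset {fset square}} :=
  [fset s in fpowerset t | `[< upset s t >]].

Lemma upsetsP s t : reflect (upset s t) (s \in upsets t).
Proof.
rewrite !inE /= fpowersetE; apply: (iffP andP) => [[_ /asboolP]//|h].
by split; [case: h|apply/asboolP].
Qed.

Definition upsets_of_class t (D : diagram_class) : {fset {fset square}} :=
  [fset s in upsets t | `[< congruent (squares (repr D)) s >]].

Lemma upsets_of_classP t D s :
  reflect (upset s t /\ congruent (squares (repr D)) s) (s \in upsets_of_class t D).
Proof.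
rewrite in_fset /= inE /=; apply: (iffP andP) => [[/upsetsP ? /asboolP]|[? ?]] //.
by split; [apply/upsetsP|apply/asboolP].
Qed.

(** The partition al corresponds to the set of squares removed. *)
Lemma nremovableE la D : nremovable la D = #|` upsets_of_class (diagram la) D|.
Proof.
rewrite /nremovable.
have mem al : al \in fset_set (removable la D) <-> removable la D al.
  by rewrite in_fset_set ?inE //; apply: finite_removable.
pose f (al : integer_partition) := diagram la `\` diagram al.
have <- : #|` f @` fset_set (removable la D)| = #|` fset_set (removable la D)|.
  rewrite card_in_imfset // => al be /mem[h _] /mem[h' _] e; apply: diagram_inj.
  by rewrite -(fsetDK h) -/(f al) e /f fsetDK.
congr #|` _|; apply/fsetP=> s.
apply/imfsetP/upsets_of_classP => /= [[al /mem[h hD] ->]|].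
  split; first exact: diagram_skew_upset.
  by move/class_ofE: hD.
move=> [/upset_skew[al h ->] cD]; exists al => //.
by apply/mem; exists h; apply/class_ofE.
Qed.

Lemma upset_sub u s t : upset u t -> u `<=` s -> s `<=` t -> upset u s.
Proof.
move=> [_ up] us st; split=> // x y xu /(fsubsetP st) yt; exact: up.
Qed.

Lemma upset_trans u s t : upset u s -> upset s t -> upset u t.
Proof.
move=> [us uu] [st up]; split; first exact: fsubset_trans us st.
move=> x y xu yt xy; apply: uu (xy) => //; apply: up xy => //.
exact: (fsubsetP us).
Qed.

Lemma upsetU s1 s2 t : upset s1 t -> upset s2 t -> upset (s1 `|` s2) t.
Proof.
move=> [s1t u1] [s2t u2]; split; first by rewrite fsubUset s1t.
move=> x y /[!in_fsetU] /orP[] xs yt xy; first by rewrite (u1 x).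
by rewrite (u2 x) ?orbT.
Qed.

(** Of two adjacent squares, one is the east or south neighbour of the other and
    so belongs to every upset that contains the other. *)
Lemma upset_disjoint_nonadjacent s1 s2 t : upset s1 t -> upset s2 t ->
  [disjoint s1 & s2] -> {in s1 & s2, forall x y, ~~ adjacent x y}.
Proof.
move=> [s1t u1] [s2t u2] /fdisjointP dis x y x1 y2.
have half a b : a \in s1 -> b \in s2 -> east a b || south a b = false.
  move=> a1 b2; apply/negP => ab.
  by have /negP := dis _ (u1 a b a1 (fsubsetP s2t _ b2) ab); apply.
have half' a b : a \in s1 -> b \in s2 -> east b a || south b a = false.
  move=> a1 b2; apply/negP => ba; have /negP := dis _ a1.
  by apply; apply: u2 b2 (fsubsetP s1t _ a1) ba.
rewrite adjacentE; have := half _ _ x1 y2; have := half' _ _ x1 y2.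
by move=> /norP[/negPf-> /negPf->] /norP[/negPf-> /negPf->].
Qed.

Lemma rigid_upset s u phi : rigid s phi -> upset u s ->
  upset (phi @` u) (phi @` s).
Proof.
move=> [inj rd] [us up]; split; first exact/subset_imfset/fsubsetP.
move=> _ _ /imfsetP[x /= xu ->] /imfsetP[y /= ys ->].
have [-> ->] := rd x y (fsubsetP us _ xu) ys => xy.
by apply: in_imfset; apply: up xu ys xy.
Qed.

Lemma rigid_comp s phi psi : rigid s phi -> rigid (phi @` s) psi ->
  rigid s (psi \o phi).
Proof.
move=> [inj rd] [inj' rd']; split=> x y xs ys /=.
  by move=> /inj'; rewrite !in_imfset // => /(_ isT isT) /inj ->.
have [-> ->] := rd' _ _ (in_imfset _ phi xs) (in_imfset _ phi ys).
exact: rd.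
Qed.

Lemma congruent_trans s t u : congruent s t -> congruent t u -> congruent s u.
Proof.
move=> [phi rphi ->] [psi rpsi ->]; exists (psi \o phi).
  exact: rigid_comp.
by rewrite [RHS]imfset_comp.
Qed.

(** * Coverings by two upsets *)

Lemma congruent_imfset s u phi : rigid s phi -> u `<=` s -> congruent u (phi @` u).
Proof. by move=> rphi us; exists phi => //; apply: rigid_sub rphi. Qed.

(** The cardinal of this set, for s in a class E, is the coefficient c(E) of
    r_la(E) in the product r_la(D1) r_la(D2). *)
Definition covering_pairs (D1 D2 : diagram_class) s :=
  [fset p in upsets_of_class s D1 `*` upsets_of_class s D2 | p.1 `|` p.2 == s].

Lemma covering_pairsP D1 D2 s p : reflect
  [/\ p.1 \in upsets_of_class s D1, p.2 \in upsets_of_class s D2 & p.1 `|` p.2 = s]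
  (p \in covering_pairs D1 D2 s).
Proof.
have -> : (p \in covering_pairs D1 D2 s) =
    [&& p.1 \in upsets_of_class s D1, p.2 \in upsets_of_class s D2 & p.1 `|` p.2 == s].
  by rewrite !inE /= -!andbA.
apply: (iffP and3P).
  by move=> [? ? /eqP].
by move=> [? ? /eqP].
Qed.

(** A rigid map of s maps the pairs covering s injectively to pairs covering its
    image; the reverse inequality comes from the inverse map. *)
Lemma card_covering_pairs_congruent D1 D2 s t : congruent s t ->
  #|` covering_pairs D1 D2 s| = #|` covering_pairs D1 D2 t|.
Proof.
have half s' t' : congruent s' t' ->
    #|` covering_pairs D1 D2 s'| <= #|` covering_pairs D1 D2 t'|.
  move=> [phi rphi ->].
  pose f (p : {fset square} * {fset square}) := (phi @` p.1, phi @` p.2).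
  have cut u v : u `<=` s' -> v `<=` s' -> phi @` u = phi @` v -> u `<=` v.
    move=> us vs /fsetP e; apply/fsubsetP => x xu; have := e (phi x).
    rewrite in_imfset // => /esym/imfsetP[y /= yv].
    have [inj rd] := rphi.
    by move=> /inj -> //; [apply: (fsubsetP us)|apply: (fsubsetP vs)].
  have finj : {in covering_pairs D1 D2 s' &, injective f}.
    move=> [a b] [a' b'] ab ab' [ea eb].
    have sub u v D' : u \in upsets_of_class v D' -> u `<=` v.
      by move=> /upsets_of_classP[[]].
    case: (covering_pairsP _ _ _ _ ab) => /sub sa /sub sb _.
    case: (covering_pairsP _ _ _ _ ab') => /sub sa' /sub sb' _.
    have -> : a = a' by apply/eqP; rewrite eqEfsubset (cut a a') // (cut a' a).
    by have -> : b = b' by apply/eqP; rewrite eqEfsubset (cut b b') // (cut b' b).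
  have <- : #|` f @` covering_pairs D1 D2 s'| = #|` covering_pairs D1 D2 s'|.
    exact: card_in_imfset.
  apply: fsubset_leq_card; apply/fsubsetP => z /imfsetP[[a b] ab ->] {z}.
  have [/upsets_of_classP[ua ca] /upsets_of_classP[ub cb] e] :=
    covering_pairsP _ _ _ _ ab.
  apply/covering_pairsP; split.
  - apply/upsets_of_classP; split; first exact: rigid_upset.
    by apply: congruent_trans ca _; apply: congruent_imfset rphi _; case: ua.
  - apply/upsets_of_classP; split; first exact: rigid_upset.
    by apply: congruent_trans cb _; apply: congruent_imfset rphi _; case: ub.
  - by rewrite -e; apply/esym/imfsetU.
by move=> st; apply/eqP; rewrite eqn_leq !half //; apply: congruent_sym.
Qed.

(** Both unions are disjoint and without adjacency across, so that the two rigid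
    maps impose no condition on each other. *)
Lemma congruent_glue s1 s2 t1 t2 : congruent s1 t1 -> congruent s2 t2 ->
  [disjoint s1 & s2] -> [disjoint t1 & t2] ->
  {in s1 & s2, forall x y, ~~ adjacent x y} ->
  {in t1 & t2, forall x y, ~~ adjacent x y} ->
  congruent (s1 `|` s2) (t1 `|` t2).
Proof.
move=> [phi1 [inj1 rd1] ->] [phi2 [inj2 rd2] ->] dis dis' nadj nadj'.
pose phi x := if x \in s1 then phi1 x else phi2 x.
have phi1E x : x \in s1 -> phi x = phi1 x by rewrite /phi => ->.
have phi2E x : x \in s2 -> phi x = phi2 x.
  by rewrite /phi => x2; case: ifP => // x1; have := fdisjointP dis _ x1; rewrite x2.
have neq x y : x \in s1 -> y \in s2 -> phi1 x <> phi2 y.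
  move=> x1 y2 e; have := fdisjointP dis' (phi1 x) (in_imfset _ phi1 x1).
  by rewrite e in_imfset.
have cross x y : x \in s1 -> y \in s2 ->
    [/\ east (phi1 x) (phi2 y) = east x y, east (phi2 y) (phi1 x) = east y x,
        south (phi1 x) (phi2 y) = south x y & south (phi2 y) (phi1 x) = south y x].
  move=> x1 y2; have := nadj _ _ x1 y2.
  have := nadj' _ _ (in_imfset _ phi1 x1) (in_imfset _ phi2 y2).
  rewrite !adjacentE !negb_or => /and4P[/negPf-> /negPf-> /negPf-> /negPf->].
  by move=> /and4P[/negPf-> /negPf-> /negPf-> /negPf->].
exists phi; last first.
  rewrite imfsetU; congr (_ `|` _).
    by apply: eq_in_imfset => // x x1; rewrite phi1E.
  by apply: eq_in_imfset => // x x2; rewrite phi2E.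
split=> x y /fsetUP[]xs /fsetUP[]ys.
- by rewrite !phi1E //; apply: inj1.
- by rewrite (phi1E _ xs) (phi2E _ ys) => /(neq _ _ xs ys).
- by rewrite (phi2E _ xs) (phi1E _ ys) => /esym/(neq _ _ ys xs).
- by rewrite !phi2E //; apply: inj2.
- by rewrite !phi1E //; apply: rd1.
- by rewrite (phi1E _ xs) (phi2E _ ys); have [-> _ -> _] := cross _ _ xs ys.
- by rewrite (phi2E _ xs) (phi1E _ ys); have [_ -> _ ->] := cross _ _ ys xs.
- by rewrite !phi2E //; apply: rd2.
Qed.

Lemma congruent_class_size D s :
  congruent (squares (repr D)) s -> #|` s| = class_size D.
Proof. by move=> /congruent_card. Qed.

Lemma covering_pairs_size D1 D2 s p : p \in covering_pairs D1 D2 s ->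
  (class_size D1 <= #|` s| <= class_size D1 + class_size D2)%N.
Proof.
move=> /covering_pairsP[/upsets_of_classP[_ c1] /upsets_of_classP[_ c2] <-].
have [e1 e2] := (congruent_class_size c1, congruent_class_size c2).
rewrite -e1 -e2 fsubset_leq_card ?fsubsetUl //=.
by rewrite cardfsU leq_subr.
Qed.

Lemma covering_pairs_disjoint D1 D2 s p : p \in covering_pairs D1 D2 s ->
  #|` s| = (class_size D1 + class_size D2)%N -> [disjoint p.1 & p.2].
Proof.
move=> /covering_pairsP[/upsets_of_classP[_ c1] /upsets_of_classP[_ c2] <-].
have [e1 e2] := (congruent_class_size c1, congruent_class_size c2).
have := cardfsUI p.1 p.2; rewrite -e1 -e2 => <- /eqP.
by rewrite -[X in X == _]addn0 eqn_add2l eq_sym cardfs_eq0 -fsetI_eq0.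
Qed.

(** A class is determined by the number k of its squares and, once these are
    numbered, by the two neighbour relations on the numbers below k. *)
Lemma finite_classes n : finite_set [set D : diagram_class | class_size D <= n]%classic.
Proof.
pose sq (D : diagram_class) i := nth (0, 0) (enum_fset (squares (repr D))) i.
(* Indices beyond the size of D read the default square; the size, which is part
   of the code, tells which entries matter. *)
pose code (D : diagram_class) : 'I_n.+1 * {ffun 'I_n * 'I_n -> bool * bool} :=
  (inord (class_size D),
   [ffun ij : 'I_n * 'I_n => (east (sq D ij.1) (sq D ij.2),
                              south (sq D ij.1) (sq D ij.2))]).
suff inj : {in [set D : diagram_class | class_size D <= n]%classic &, injective code}.
  by rewrite -(eq_finite_set (inj_card_eq inj)); apply: finite_finset.
move=> D E /set_mem /= Dn /set_mem /= En [].
move=> /(congr1 (@nat_of_ord _)); rewrite !inordK // => szDE /ffunP codeE.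
rewrite -[E]reprK; apply/esym/class_ofE.
have iE x : x \in squares (repr D) ->
    index x (enum_fset (squares (repr D))) < class_size D.
  by move=> xs; rewrite index_mem.
have iE' x : x \in squares (repr D) ->
    index x (enum_fset (squares (repr D))) < #|` squares (repr E)|.
  by move=> /iE; rewrite szDE.
have sqK x : x \in squares (repr D) ->
    sq D (index x (enum_fset (squares (repr D)))) = x.
  by move=> xs; apply: nth_index.
pose phi x := sq E (index x (enum_fset (squares (repr D)))).
exists phi; first split.
- move=> x y xs ys /eqP; rewrite nth_uniq ?iE' ?fset_uniq // => /eqP e.
  by rewrite -(sqK x xs) e sqK.
- move=> x y xs ys.
  have xn := leq_trans (iE _ xs) Dn; have yn := leq_trans (iE _ ys) Dn.
  have := codeE (Ordinal xn, Ordinal yn); rewrite !ffunE /= !sqK //.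
  by case=> -> ->.
apply/fsetP=> y; apply/idP/imfsetP => [ys|[x /= xs ->]]; last first.
  by rewrite mem_nth // iE'.
exists (sq D (index y (enum_fset (squares (repr E))))).
  by rewrite /= mem_nth // -[X in _ < X]/(class_size D) szDE index_mem.
rewrite /phi index_uniq ?fset_uniq //; first by rewrite /sq nth_index.
by rewrite -[X in _ < X]/(class_size D) szDE index_mem.
Qed.

(** * Products of removal numbers *)

Lemma sum_eq_mem (I : eqType) (r : seq I) (i : I) : uniq r ->
  (\sum_(j <- r) (i == j))%N = (i \in r).
Proof.
move=> ur; rewrite -count_uniq_mem // -sum1_count [RHS]big_mkcond /=.
by apply: eq_bigr => j _; rewrite eq_sym; case: eqP.
Qed.

Lemma in_fset_cond (T : choiceType) (A : {fset T}) (P : pred T) (x : T) :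
  (x \in [fset y in A | P y]) = (x \in A) && P x.
Proof. by rewrite !inE. Qed.

Lemma card_fset_cond (T : choiceType) (A : {fset T}) (P : pred T) :
  #|` [fset x in A | P x]| = (\sum_(x <- A) P x)%N.
Proof.
rewrite -sum1_size big_fset [LHS]big_mkcond /=.
by apply: eq_bigr => j _; case: (P j).
Qed.

Lemma card_fsetM (T T' : choiceType) (A : {fset T}) (B : {fset T'}) :
  #|` A `*` B| = (#|` A| * #|` B|)%N.
Proof.
rewrite -(size_allpairs pair); apply/perm_size/uniq_perm.
- exact: fset_uniq.
- by apply: allpairs_uniq => [||[a b] [c d] _ _ []-> ->]; rewrite ?fset_uniq.
move=> [a b]; rewrite in_fsetM /=; apply/andP/allpairsP => /=.
  by move=> [aA bB]; exists (a, b).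
by move=> [[c d] /= [cA dB [-> ->]]].
Qed.

(** Upsets of s are the upsets of t contained in s, so a fibre of the union map
    on pairs of upsets of t does not depend on t. *)
Lemma covering_pairs_upset t D1 D2 s : upset s t ->
  covering_pairs D1 D2 s =
  [fset p in upsets_of_class t D1 `*` upsets_of_class t D2 | p.1 `|` p.2 == s].
Proof.
move=> us; have st := us.1.
have upsets_of_classE u D :
    u `<=` s -> (u \in upsets_of_class s D) = (u \in upsets_of_class t D).
  move=> uns; apply/upsets_of_classP/upsets_of_classP => -[uu cu]; split=> //.
    exact: upset_trans us.
  exact: upset_sub uu uns st.
apply/fsetP => p; rewrite /covering_pairs !in_fset_cond !in_fsetM.
have [e|] := eqVneq (p.1 `|` p.2) s; rewrite ?andbF // !andbT.
by rewrite !upsets_of_classE // -e ?fsubsetUl ?fsubsetUr.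
Qed.

Lemma card_upsets_of_classM (t : {fset square}) D1 D2 :
  (#|` upsets_of_class t D1| * #|` upsets_of_class t D2|)%N =
  (\sum_(s <- upsets t) #|` covering_pairs D1 D2 s|)%N.
Proof.
rewrite -card_fsetM.
transitivity (\sum_(p <- upsets_of_class t D1 `*` upsets_of_class t D2)
    \sum_(s <- upsets t) (p.1 `|` p.2 == s))%N.
  rewrite -sum1_size big_seq [RHS]big_seq; apply: eq_bigr => p.
  rewrite in_fsetM => /andP[/upsets_of_classP[u1 _] /upsets_of_classP[u2 _]].
  rewrite sum_eq_mem ?fset_uniq //.
  by have /upsetsP -> := upsetU u1 u2.
rewrite exchange_big /= big_seq [RHS]big_seq; apply: eq_bigr => s /upsetsP us.
by rewrite (covering_pairs_upset _ _ us) card_fset_cond.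
Qed.

(** Sort the pairs of upsets by their union, then the unions by their class; the
    hypothesis on F says that no union is missed. *)
Lemma nremovableM (la : integer_partition) D1 D2 (F : {fset diagram_class}) :
  (forall E p, p \in covering_pairs D1 D2 (squares (repr E)) -> E \in F) ->
  (nremovable la D1 * nremovable la D2)%N =
  (\sum_(E <- F) #|` covering_pairs D1 D2 (squares (repr E))| * nremovable la E)%N.
Proof.
move=> FP; rewrite !nremovableE card_upsets_of_classM.
transitivity (\sum_(s <- upsets (diagram la)) \sum_(E <- F)
    #|` covering_pairs D1 D2 (squares (repr E))|
      * `[< congruent (squares (repr E)) s >])%N.
  rewrite big_seq [RHS]big_seq; apply: eq_bigr => s /upsetsP us.
  have [al h es] := upset_skew us; pose E0 := class_of (Defs.skew h).
  have cE0 : congruent (squares (repr E0)) s.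
    by rewrite es; apply/(class_ofE (Defs.skew h)).
  transitivity (#|` covering_pairs D1 D2 s| * \sum_(E <- F) (E0 == E))%N.
    rewrite sum_eq_mem ?fset_uniq //.
    have [E0F|nE0F] := boolP (E0 \in F); first by rewrite muln1.
    rewrite muln0 -(card_covering_pairs_congruent _ _ cE0).
    apply/eqP; rewrite cardfs_eq0; apply/eqP/fsetP => p; rewrite in_fset0.
    by apply/negP => /FP; rewrite (negPf nE0F).
  rewrite big_distrr; apply: eq_bigr => E _ /=.
  have -> : `[< congruent (squares (repr E)) s >] = (E0 == E).
    apply/asboolP/eqP => [cs|<- //].
    by apply/(class_ofE (Defs.skew h)); rewrite /= -es.
  case: eqP => [<-|_]; last by rewrite /= !muln0.
  by rewrite -(card_covering_pairs_congruent D1 D2 cE0).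
rewrite exchange_big; apply: eq_bigr => E _ /=.
by rewrite nremovableE -big_distrr /= -card_fset_cond.
Qed.

(** D1 is the class of a component and D2 that of the other components.  Their
    union is D, and the sizes add up, so any diagram of size |D| covered by such
    a pair is a disjoint union without adjacency, glued from the same pieces. *)
Lemma disconnected_split D : 0 < class_size D -> ~~ class_connected D ->
  exists D1 D2, [/\ 0 < class_size D1, 0 < class_size D2,
    class_size D = (class_size D1 + class_size D2)%N
    & (exists p, p \in covering_pairs D1 D2 (squares (repr D)))
   /\ forall E p, p \in covering_pairs D1 D2 (squares (repr E)) ->
       class_size E = class_size D -> E = D].
Proof.
set s := squares (repr D) => D0 nconn.
have /fset0Pn[x xs] : s != fset0 by rewrite -cardfs_gt0.
have [c cs xc] := components_ex xs.
have csub := components_sub cs.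
have cl : {in c & s `\` c, forall a b, ~~ adjacent a b}.
  move=> a b ac; rewrite in_fsetD => /andP[bc bs]; apply: contra bc => ab.
  exact: (components_closed cs ac bs ab).
have sym a b : adjacent a b = adjacent b a.
  by rewrite !adjacentE orbCA; congr [|| _, _ | _]; rewrite orbC.
have cneq : 0 < #|` s `\` c|.
  rewrite cardfs_gt0; apply: contra nconn => /eqP e.
  rewrite /class_connected connectedE; apply/cardfs1P; exists c.
  have sc : s `<=` c by rewrite -fsetD_eq0 e.
  apply/fsetP => d; rewrite in_fset1; apply/idP/eqP => [ds|->//].
  have [y yd] := components_neq0 ds.
  apply: (components_eq ds cs yd).
  exact/(fsubsetP sc)/(fsubsetP (components_sub ds)).
have steps a b : east a b || south a b -> adjacent a b.
  by rewrite adjacentE => /orP[]->; rewrite ?orbT.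
have up1 : upset c s.
  split=> // a b ac bs /steps ab; exact: (components_closed cs ac bs ab).
have up2 : upset (s `\` c) s.
  split=> [|a b ac bs /steps ab]; first exact: fsubsetDl.
  rewrite in_fsetD bs andbT; apply: contraL ab => bc.
  by rewrite sym; apply: cl.
have [la [al [h es]]] : Defs.is_skew s.
  by rewrite /s; case: (repr D) => sq /= /asboolP.
have ups : upset s (diagram la) by rewrite es; apply: diagram_skew_upset.
have cls u : upset u s ->
    exists E : diagram_class, congruent (squares (repr E)) u.
  move=> us; have [be h' e] := upset_skew (upset_trans us ups).
  exists (class_of (Defs.skew h')); rewrite e.
  by apply/(class_ofE (Defs.skew h')).
have [D1 c1] := cls _ up1; have [D2 c2] := cls _ up2.
have sz1 := congruent_class_size c1; have sz2 := congruent_class_size c2.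
have szD : class_size D = (class_size D1 + class_size D2)%N.
  rewrite -sz1 -sz2; have := cardfsID c s.
  by rewrite (fsetIidPr csub) => ->.
exists D1, D2; split => //.
- by rewrite -sz1 cardfs_gt0; apply/fset0Pn; exists x.
- by rewrite -sz2.
split.
  exists (c, s `\` c); apply/covering_pairsP; split.
  - by apply/upsets_of_classP.
  - by apply/upsets_of_classP.
  - by rewrite /= fsetUDl fsetDv fsetD0; apply/fsetUidPr.
move=> E p pE szE; rewrite -[E]reprK; apply/class_ofE.
have dis := covering_pairs_disjoint pE (etrans szE szD).
have [/upsets_of_classP[u1 k1] /upsets_of_classP[u2 k2] e] :=
  covering_pairsP _ _ _ _ pE.
rewrite -e -/s -[s](fsetID c) (fsetIidPr csub).
apply: congruent_glue => //.
- exact: congruent_trans (congruent_sym c1) k1.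
- exact: congruent_trans (congruent_sym c2) k2.
- by apply/fdisjointP => a ac; rewrite in_fsetD ac.
- exact: upset_disjoint_nonadjacent u1 u2 dis.
Qed.

(** * Functions given by polynomials *)

Local Open Scope ring_scope.

(** The evaluation of monomials inside [poly_eval], named so as to carry the
    morphism structure from which [poly_eval] inherits multiplicativity. *)
Definition mon_eval (R : comNzRingType) (I : choiceType) (v : I -> R)
    (m : {cmonom I}) : R :=
  \prod_(i <- finsupp m) v i ^+ m i.

Lemma mon_evalEw (R : comNzRingType) (I : choiceType) (v : I -> R)
    (m : {cmonom I}) (d : {fset I}) :
  finsupp m `<=` d -> mon_eval v m = \prod_(i <- d) v i ^+ m i.
Proof.
move=> sub; apply: big_fset_incl sub _ => i _.
by rewrite -cmE_eq0 => /eqP->; rewrite expr0.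
Qed.

Lemma mon_eval_mmorphism (R : comNzRingType) (I : choiceType) (v : I -> R) :
  mmorphism (mon_eval v).
Proof.
split=> [m1 m2|]; last by rewrite /mon_eval mdom1 big_seq_fset0.
rewrite (@mon_evalEw _ _ _ m1 (finsupp m1 `|` finsupp m2)) ?fsubsetUl //.
rewrite (@mon_evalEw _ _ _ m2 (finsupp m1 `|` finsupp m2)) ?fsubsetUr //.
rewrite (@mon_evalEw _ _ _ _ (finsupp m1 `|` finsupp m2)) ?mdomD //.
by rewrite -big_split; apply: eq_bigr => i _; rewrite cmM exprD.
Qed.

HB.instance Definition _ (R : comNzRingType) (I : choiceType) (v : I -> R) :=
  isMultiplicative.Build {cmonom I} R (mon_eval v) (mon_eval_mmorphism v).

(** One polynomial has to serve for all parameters w, here the partitions; v w is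
    the point of evaluation, and A confines the variables that occur. *)
Definition polyfun (T : Type) (I : choiceType) (v : T -> I -> rat) (A : set I)
    (f : T -> rat) :=
  exists2 p : mpolynomial rat I,
    (forall w, f w = poly_eval (v w) p) & (poly_vars p `<=` A)%classic.

Section Polyfun.
Variables (T : Type) (I : choiceType) (v : T -> I -> rat) (A : set I).
Implicit Types f g : T -> rat.

Lemma polyfun_var i : A i -> polyfun v A (fun w => v w i).
Proof.
move=> Ai; exists << ucm i >> => [w|j [m]].
  rewrite /poly_eval mmapU /= mul1r -/(mon_eval _ _).
  by rewrite /mon_eval mdomU big_seq_fset1 cmUU expr1.
by rewrite msuppU1 in_fset1 => /eqP->; rewrite mdomU in_fset1 => /eqP->.
Qed.

Lemma polyfunD f g : polyfun v A f -> polyfun v A g ->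
  polyfun v A (fun w => f w + g w).
Proof.
move=> [p pE pA] [q qE qA]; exists (p + q) => [w|i [m]].
  by rewrite pE qE /poly_eval mmapD.
move=> /(fsubsetP (msuppD_le _ _)) /fsetUP[] mp im.
  by apply: pA; exists m.
by apply: qA; exists m.
Qed.

Lemma polyfunM f g : polyfun v A f -> polyfun v A g ->
  polyfun v A (fun w => f w * g w).
Proof.
move=> [p pE pA] [q qE qA]; exists (p * q) => [w|i [m]].
  by rewrite pE qE -[RHS]/(mmap idfun (mon_eval (v w)) (p * q)) rmorphM.
move=> /msuppM_le[k1 [k2 [k1p k2q ->]]]; rewrite mdomD => /fsetUP[] ik.
  by apply: pA; exists k1.
by apply: qA; exists k2.
Qed.

Lemma polyfunZ f (a : rat) : polyfun v A f -> polyfun v A (fun w => a * f w).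
Proof.
move=> [p pE pA]; exists (a *: p) => [w|i [m]].
  by rewrite pE -[RHS]/(mmap idfun (mon_eval (v w)) (a *: p)) mmapZ.
by move=> /(fsubsetP (msuppZ_le _ _)) mp im; apply: pA; exists m.
Qed.

Lemma polyfun_sum (J : eqType) (r : seq J) (F : J -> T -> rat) :
  (forall j, j \in r -> polyfun v A (F j)) ->
  polyfun v A (fun w => \sum_(j <- r) F j w).
Proof.
elim: r => [|j r IH] rP.
  exists 0 => [w|i [m]]; first by rewrite big_nil /poly_eval mmap0.
  by rewrite msupp0.
have [||p pE pA] := @polyfunD (F j) (fun w => \sum_(j <- r) F j w).
- by apply: rP; rewrite mem_head.
- by apply: IH => k kr; apply: rP; rewrite in_cons kr orbT.
by exists p => // w; rewrite big_cons pE.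
Qed.

End Polyfun.

Lemma polyfunS T (I : choiceType) (v : T -> I -> rat) (A B : set I) f :
  (A `<=` B)%classic -> polyfun v A f -> polyfun v B f.
Proof. by move=> AB [p pE pA]; exists p => // i /pA /AB. Qed.

(** * The theorem *)

Definition rvar n (la : integer_partition) (C : class_var n) : rat :=
  (nremovable la (val C))%:R.

(** The bound n on the variables stays fixed while the induction is on the size
    of D: in this way all the polynomials live in the same ring. *)
Lemma nremovable_polyfun n D : (0 < class_size D <= n)%N ->
  if class_connected D
  then polyfun (@rvar n) [set C | class_size (val C) <= class_size D]%N%classic
         (fun la => (nremovable la D)%:R)
  else polyfun (@rvar n) [set C | class_size (val C) < class_size D]%N%classic
         (fun la => (nremovable la D)%:R).
Proof.
have [k] := ubnP (class_size D); elim: k D => // k IH D.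
rewrite ltnS => Dk /andP[D0 Dn]; case: ifP => [conn|/negbT nconn].
  have Cok : class_connected D && (0 < class_size D <= n)%N by rewrite conn D0.
  by apply: (@polyfun_var _ _ (@rvar n) _ (exist _ D Cok)) => /=.
set A := [set C | _]%classic.
have small E : (0 < class_size E < class_size D)%N ->
    polyfun (@rvar n) A (fun la => (nremovable la E)%:R).
  move=> /andP[E0 ED]; have := IH E (leq_trans ED Dk).
  rewrite E0 (leq_trans (ltnW ED) Dn) => /(_ isT).
  by case: ifP => _; apply: polyfunS => C /= /leq_ltn_trans;
    [apply|move/(_ _ ED)/ltnW].
have [D1 [D2 [s1 s2 sD [[p pD] full]]]] := disconnected_split D0 nconn.
pose F := fset_set [set E : diagram_class | class_size E <= class_size D]%N%classic.
have FE E : (E \in F) = (class_size E <= class_size D)%N.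
  rewrite in_fset_set; last exact: finite_classes.
  by apply/idP/idP => [/set_mem //|?]; apply/mem_set.
have inF E q : q \in covering_pairs D1 D2 (squares (repr E)) -> E \in F.
  by move=> /covering_pairs_size /andP[_]; rewrite FE sD.
pose c E : nat := #|` covering_pairs D1 D2 (squares (repr E))|.
have cD : (c D)%:R != 0 :> rat.
  rewrite Num.Theory.pnatr_eq0 -lt0n cardfs_gt0; apply/fset0Pn; by exists p.
(* The product formula, solved for the term of D. *)
have solve la : (nremovable la D)%:R = (c D)%:R^-1 *
    ((nremovable la D1)%:R * (nremovable la D2)%:R
     + (-1) * \sum_(E <- F `\ D) (c E)%:R * (nremovable la E)%:R) :> rat.
  rewrite -natrM (nremovableM la inF) (big_fsetD1 D) ?FE //= natrD natr_sum.
  under [X in _ * (_ + X + _)]eq_bigr do rewrite natrM.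
  by rewrite mulN1r addrK natrM mulKf.
suff [q qE qA] : polyfun (@rvar n) A (fun la => (c D)%:R^-1 *
    ((nremovable la D1)%:R * (nremovable la D2)%:R
     + (-1) * \sum_(E <- F `\ D) (c E)%:R * (nremovable la E)%:R)).
  by exists q => // la; rewrite solve qE.
apply/polyfunZ/polyfunD.
  by apply: polyfunM; apply: small; clear -s1 s2 sD; lia.
apply/polyfunZ/polyfun_sum => E; rewrite in_fsetD1 FE => /andP[ED Es].
have [cE0|[q qE]] := fset_0Vmem (covering_pairs D1 D2 (squares (repr E))).
  by exists 0 => [la|i [m]]; rewrite ?msupp0 // /c cE0 mul0r /poly_eval mmap0.
apply/polyfunZ/small.
have /andP[E1 _] := covering_pairs_size qE.
rewrite (leq_trans s1 E1) /= ltn_neqAle Es andbT.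
by apply: contra ED => /eqP eE; apply/eqP; apply: full qE eE.
Qed.

Theorem theorem5p20 (D : diagram_class) (D_nonempty : (0 < class_size D)%N) :
  exists p : mpolynomial rat (class_var (class_size D)),
    (forall la : integer_partition,
       ((nremovable la D)%:R : rat)%R =
       poly_eval
         (fun C : class_var (class_size D) => ((nremovable la (val C))%:R : rat)%R)
         p) /\
    (~~ class_connected D ->
     forall C : class_var (class_size D),
       poly_vars p C -> (class_size (val C) < class_size D)%N).
Proof.
have := @nremovable_polyfun (class_size D) D; rewrite D_nonempty leqnn.
by move=> /(_ isT); case: ifP => _ [p pE pA]; exists p; split=> // _ C /pA.
Qed.
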